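(* Let $X$ be a separable complex Banach space, let $\Omega \subseteq X$ be a domain, and let $\mathcal{F} = \{f_\alpha\}_{\alpha \in \mathcal{A}}$ be a family of holomorphic functions $f_\alpha : \Omega \to \mathbb{C}$. Assume that $\mathcal{F}$ is uniformly bounded on compact sets, in the sense that for each compact $L \subseteq \Omega$ there is a constant $M_L > 0$ such that $|f_\alpha(z)| \leq M_L$ for every $z \in L$ and every $f_\alpha \in \mathcal{F}$. Then every sequence in $\mathcal{F}$ has a subsequence that converges uniformly on each compact set $K \subseteq \Omega$ (a single subsequence that works for every compact $K$). Thus $\mathcal{F}$ is a normal family.
   Context: A domain $\Omega \subseteq X$ is a connected open set. For a function $u$ on $\Omega$, $q \in \Omega$ and $v \in X$, put $du(q;v) = \lim_{\mathbb{R} \ni \epsilon \to 0} \frac{u(q+\epsilon v) - u(q)}{\epsilon}$ and $\overline{D}u(q;v) = \frac{1}{2}\big(du(q;v) + i\, du(q; iv)\big)$. The function $u$ is $C^1$ if $du(q;v)$ exists for all $q \in \Omega$, $v \in X$ and $(q,v) \mapsto du(q;v)$ is continuous. A $C^1$ function $f$ on $\Omega$ is holomorphic if $\overline{D}f \equiv 0$ on $\Omega$ (equivalently, for $C^1$ functions, the restriction of $f$ to every complex line is holomorphic in the one-variable sense). A family $\mathcal{F}$ of holomorphic functions on $\Omega$ is a normal family if every sequence $\{f_j\} \subseteq \mathcal{F}$ either (normal convergence) has a subsequence that converges uniformly on compact subsets of $\Omega$, or (compact divergence) has a subsequence $\{f_{j_k}\}$ such that, for each compact $K \subseteq \Omega$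 and each compact $L \subseteq \mathbb{C}$, there is a number $N$ such that $f_{j_k}(K) \cap L = \emptyset$ for all $k \geq N$. *)

(* Defs.v *)
From HB Require Import structures.
From mathcomp Require Import all_boot all_order all_algebra.
From mathcomp Require Import all_classical all_reals all_analysis.
From mathcomp Require Import complex.

Set Implicit Arguments.
Unset Strict Implicit.
Unset Printing Implicit Defensive.

Import Order.TTheory GRing.Theory Num.Theory numFieldNormedType.Exports.

Local Open Scope classical_set_scope.
Local Open Scope ring_scope.
Local Open Scope complex_scope.

(* The norm topology on R[i]: numFieldNormedType attaches it to abstract
   numFieldTypes and to R[i]^o, but not to the concrete type R[i]. *)
HB.instance Definition _ (R : realType) := NormedModule.copy R[i] R[i]^o.

Section Holomorphy.
Context {R : realType} {X : normedModType R[i]}.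
Implicit Types (Omega : set X) (u : X -> R[i]) (q v : X).

(* A function on Omega is represented by a total function on X of which only
   the values on Omega matter: for q in the open set Omega and small e, the
   point q + e v lies in Omega. The increment e is real. *)
Definition diff_quotient u q v (e : R) : R[i] :=
  (u (q + e%:C *: v) - u q) / e%:C.

Definition du u q v : R[i] := lim (diff_quotient u q v e @[e --> 0^']).

Definition Dbar u q v : R[i] := 2^-1 * (du u q v + 'i * du u q ('i *: v)).

Definition is_domain Omega := open Omega /\ connected Omega.

(* The convergence clause gives meaning to the total operator lim in du. *)
Definition C1_on Omega u :=
  (forall q v, Omega q -> cvg (diff_quotient u q v e @[e --> 0^'])) /\
  {within Omega `*` [set: X], continuous (fun p : X * X => du u p.1 p.2)}.

Definition holomorphic Omega u :=
  C1_on Omega u /\ (forall q v, Omega q -> Dbar u q v = 0).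

End Holomorphy.

Definition separable (T : topologicalType) :=
  exists2 D : set T, countable D & dense D.

Section NormalFamilies.
Context {R : realType} {X : normedModType R[i]}.
Implicit Types (Omega : set X) (F : set (X -> R[i])) (s : nat -> X -> R[i]).

(* phi enumerates the indices of the subsequence. *)
Definition normally_convergent_subseq Omega s :=
  exists phi : nat -> nat, {homo phi : m n / (m < n)%N} /\
  exists g : X -> R[i], forall K : set X, compact K -> K `<=` Omega ->
    {uniform K, (fun k => s (phi k)) @ \oo --> g}.

Definition compactly_divergent_subseq Omega s :=
  exists phi : nat -> nat, {homo phi : m n / (m < n)%N} /\
  forall (K : set X) (L : set R[i]), compact K -> K `<=` Omega -> compact L ->
    exists N : nat, forall k : nat, (N <= k)%N ->
      (s (phi k) @` K) `&` L = set0.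

Definition normal_family Omega F :=
  (forall f, F f -> holomorphic Omega f) /\
  forall s, (forall j, F (s j)) ->
    normally_convergent_subseq Omega s \/ compactly_divergent_subseq Omega s.

Definition bounded_on_compacts Omega F :=
  forall L : set X, compact L -> L `<=` Omega ->
    exists M : R, 0 < M /\
      forall z f, L z -> F f -> `|f z| <= M%:C.

End NormalFamilies.

(* Main.v *)
(** A family bounded on compacts is locally bounded: otherwise points z_n -> p
    and members f_n with |f_n(z_n)| > n would contradict boundedness on the
    compact set {p, z_0, z_1, ...}. On a complex line, Cauchy's estimate turns a
    local bound into a local Lipschitz bound common to the family. Cauchy's
    estimate itself is obtained without integration, from averages of
    g(s w^k) w^-k over the powers of a root of unity w close to 1: dividing the
    average by s gives a function of s which is almost constant, is at most M/r
    in modulus at s = r, and is close to g'(0) for small s. Finally, by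
    Tychonoff's theorem a sequence in the family has a pointwise cluster point
    c; some subsequence converges to c on a countable dense set, and
    equicontinuity upgrades this to uniform convergence on compacts. *)
Require Import Defs.
From HB Require Import structures.
From mathcomp Require Import all_boot all_order all_algebra.
From mathcomp Require Import all_classical all_reals all_analysis.
From mathcomp Require Import complex.
From mathcomp Require Import ring lra.

Set Implicit Arguments.
Unset Strict Implicit.
Unset Printing Implicit Defensive.

Import Order.TTheory GRing.Theory Num.Theory numFieldNormedType.Exports.

Local Open Scope classical_set_scope.
Local Open Scope ring_scope.
Local Open Scope complex_scope.

(** * The norm as a real number *)

(** Norms over [R[i]] take values in [R[i]]; their real parts lie in the ordered field [R], where
    [lra] and [nra] apply. *)
Definition rnorm {R : realType} {V : normedZmodType R[i]} (x : V) : R :=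
  complex.Re `|x|.

Section RealNorm.
Context {R : realType}.

Lemma realCD (a b : R) : (a + b)%:C = a%:C + b%:C.
Proof. exact: rmorphD. Qed.

Lemma realCB (a b : R) : (a - b)%:C = a%:C - b%:C.
Proof. exact: rmorphB. Qed.

Lemma realCM (a b : R) : (a * b)%:C = a%:C * b%:C.
Proof. exact: rmorphM. Qed.

Lemma realCV (a : R) : (a^-1)%:C = a%:C^-1.
Proof. exact: fmorphV. Qed.

Section NormedZmod.
Context {V : normedZmodType R[i]}.
Implicit Types x y : V.

Lemma rnormE x : `|x| = (rnorm x)%:C.
Proof. by rewrite /rnorm RRe_real // normr_real. Qed.

Lemma rnorm_ge0 x : 0 <= rnorm x.
Proof. by rewrite -lecR -rnormE normr_ge0. Qed.

Lemma rnormD x y : rnorm (x + y) <= rnorm x + rnorm y.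
Proof.
by rewrite -lecR realCD -!rnormE ler_normD.
Qed.

Lemma rnormN x : rnorm (- x) = rnorm x.
Proof. by rewrite /rnorm normrN. Qed.

Lemma rnorm_distC x y : rnorm (x - y) = rnorm (y - x).
Proof. by rewrite /rnorm distrC. Qed.

Lemma rnorm0 : rnorm (0 : V) = 0.
Proof. by rewrite /rnorm normr0. Qed.

Lemma rnorm_gt0 x : (0 < rnorm x) = (x != 0).
Proof. by rewrite -ltcR -rnormE normr_gt0. Qed.

Lemma rnorm_distD y x z : rnorm (x - z) <= rnorm (x - y) + rnorm (y - z).
Proof. by apply: le_trans (rnormD _ _); rewrite addrA subrK. Qed.

Lemma rnorm_sum (I : Type) (s : seq I) (F : I -> V) :
  rnorm (\sum_(i <- s) F i) <= \sum_(i <- s) rnorm (F i).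
Proof.
elim/big_ind2: _ => [|x a y b xa yb|//]; first by rewrite rnorm0.
by apply: le_trans (rnormD _ _) _; exact: lerD.
Qed.

End NormedZmod.

Lemma rnormM (x y : R[i]) : rnorm (x * y) = rnorm x * rnorm y.
Proof. by apply: complexI; rewrite realCM -!rnormE normrM. Qed.

Lemma rnormV (x : R[i]) : rnorm x^-1 = (rnorm x)^-1.
Proof. by apply: complexI; rewrite realCV -!rnormE normfV. Qed.

Lemma rnormC (a : R) : rnorm a%:C = `|a|.
Proof. by rewrite /rnorm normc_def /= expr0n addr0 sqrtr_sqr. Qed.

Lemma rnorm1 : rnorm (1 : R[i]) = 1.
Proof. by rewrite /rnorm normr1. Qed.

Lemma rnormX (x : R[i]) n : rnorm (x ^+ n) = rnorm x ^+ n.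
Proof. by elim: n => [|n IH]; rewrite ?expr0 ?rnorm1// !exprS rnormM IH. Qed.

Lemma rnorm_scale (V : normedModType R[i]) (a : R[i]) (x : V) :
  rnorm (a *: x) = rnorm a * rnorm x.
Proof. by apply: complexI; rewrite realCM -!rnormE normrZ. Qed.

Lemma Re_le_rnorm (z : R[i]) : `|complex.Re z| <= rnorm z.
Proof. by rewrite -lecR -rnormE normc_ge_Re. Qed.

Lemma Im_le_rnorm (z : R[i]) : `|complex.Im z| <= rnorm z.
Proof.
case: z => a b; rewrite /rnorm normc_def /= -sqrtr_sqr ler_wsqrtr//.
by rewrite lerDr sqr_ge0.
Qed.

Lemma rnorm_le_ReIm (z : R[i]) :
  rnorm z <= `|complex.Re z| + `|complex.Im z|.
Proof.
rewrite {1}[z]complexE; apply: le_trans (rnormD _ _) _.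
rewrite rnormM !rnormC; suff -> : rnorm ('i : R[i]) = 1 by rewrite mul1r.
by rewrite /rnorm normc_def /= expr0n expr1n add0r sqrtr1.
Qed.

Lemma nbhs_rnormP (V : normedModType R[i]) (p : V) (P : set V) :
  nbhs p P <-> exists2 e : R, 0 < e & forall y, rnorm (y - p) < e -> P y.
Proof.
split=> [/nbhs_ballP[e /= e0 eP]|[e e0 eP]].
  have eE : (complex.Re e)%:C = e by rewrite RRe_real// gtr0_real.
  exists (complex.Re e) => [|y ype]; first by rewrite -ltcR eE.
  by apply: eP; rewrite -ball_normE /= rnormE rnorm_distC -eE ltcR.
apply/nbhs_ballP; exists e%:C => /=; first by rewrite ltcR.
move=> y; rewrite -ball_normE /= rnormE ltcR rnorm_distC; exact: eP.
Qed.

Lemma cvg_rnormP (V : normedModType R[i]) (T : Type) (F : set_system T)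
    (FF : Filter F) (f : T -> V) (l : V) :
  f x @[x --> F] --> l <->
  forall e : R, 0 < e -> \forall x \near F, rnorm (f x - l) < e.
Proof.
split=> [fl e e0|fl P /nbhs_rnormP[e e0 eP]].
  suff /fl : nbhs l [set y | rnorm (y - l) < e] by [].
  by apply/nbhs_rnormP; exists e.
rewrite /nbhs/=; apply: filterS (fl e e0) => x; exact: eP.
Qed.

End RealNorm.

(** * Derivatives of complex-valued functions of a real variable *)

(** Splitting into real and imaginary parts gives access to the rules of real calculus and to the
    mean value theorem. *)
Definition is_cder {R : realType} (phi : R -> R[i]) (t : R) (l : R[i]) :=
  is_derive t 1 (fun s => complex.Re (phi s)) (complex.Re l) /\
  is_derive t 1 (fun s => complex.Im (phi s)) (complex.Im l).

Section ComplexValuedDerivative.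
Context {R : realType}.
Implicit Types (phi psi : R -> R[i]) (t a b : R) (l : R[i]).

Lemma is_derive_cvg_quot (f : R -> R) t (l : R) :
  (f (t + e) - f t) / e @[e --> 0^'] --> l -> is_derive t 1 f l.
Proof.
move=> fl.
have E : (fun e => (f (t + e) - f t) / e) =
    (fun e => e^-1 *: (f (e *: (1 : R) + t) - f t)).
  apply/funext => e; rewrite [LHS]mulrC; congr (_ * (f _ - _)).
  by rewrite /GRing.scale/= mulr1 addrC.
rewrite E in fl.
by split; [apply/cvg_ex; exists l|exact: cvg_lim].
Qed.

Lemma is_cder_cvg_quot phi t l :
  (phi (t + e) - phi t) / e%:C @[e --> 0^'] --> l -> is_cder phi t l.
Proof.
have ReE (z : R[i]) (e : R) : complex.Re (z / e%:C) = complex.Re z / e.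
  by rewrite -realCV; case: z => x y /=; rewrite mulr0 subr0.
have ImE (z : R[i]) (e : R) : complex.Im (z / e%:C) = complex.Im z / e.
  by rewrite -realCV; case: z => x y /=; rewrite mulr0 add0r.
move=> /cvg_rnormP phil; split; apply: is_derive_cvg_quot;
  apply/cvgrPdist_lt => eps eps0; apply: filterS (phil eps eps0) => e;
  apply: le_lt_trans; rewrite distrC.
  rewrite -(raddfB (@complex.Re R)) -ReE -(raddfB (@complex.Re R)).
  exact: Re_le_rnorm.
rewrite -(raddfB (@complex.Im R)) -ImE -(raddfB (@complex.Im R)).
exact: Im_le_rnorm.
Qed.

Lemma is_cderD phi psi t l l' : is_cder phi t l -> is_cder psi t l' ->
  is_cder (fun s => phi s + psi s) t (l + l').
Proof.
move=> [pr pi] [qr qi]; split.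
  have := is_deriveD pr qr; rewrite -(raddfD (@complex.Re R)).
  by congr is_derive; apply/funext => s /=; rewrite raddfD.
have := is_deriveD pi qi; rewrite -(raddfD (@complex.Im R)).
by congr is_derive; apply/funext => s /=; rewrite raddfD.
Qed.

Lemma is_cderZ (c : R[i]) phi t l : is_cder phi t l ->
  is_cder (fun s => c * phi s) t (c * l).
Proof.
have ReM (z w : R[i]) : complex.Re (z * w) =
    complex.Re z * complex.Re w - complex.Im z * complex.Im w.
  by case: z => x y; case: w.
have ImM (z w : R[i]) : complex.Im (z * w) =
    complex.Re z * complex.Im w + complex.Im z * complex.Re w.
  by case: z => x y; case: w.
move=> [pr pi]; split.
  have := is_deriveB (is_deriveZ (complex.Re c) pr)
    (is_deriveZ (complex.Im c) pi).
  rewrite ReM; congr is_derive; by apply/funext => s /=; rewrite ReM.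
have := is_deriveD (is_deriveZ (complex.Re c) pi)
  (is_deriveZ (complex.Im c) pr).
rewrite ImM; congr is_derive; by apply/funext => s /=; rewrite ImM.
Qed.

Lemma is_cder_cst (c : R[i]) t : is_cder (fun=> c) t 0.
Proof. by split; exact: is_derive_cst. Qed.

Lemma is_cder_sum (I : Type) (r : seq I) (phi : I -> R -> R[i]) t
    (l : I -> R[i]) : (forall i, is_cder (phi i) t (l i)) ->
  is_cder (fun s => \sum_(i <- r) phi i s) t (\sum_(i <- r) l i).
Proof.
move=> phil; elim: r => [|i r IH].
  rewrite big_nil; have -> : (fun s => \sum_(i <- [::]) phi i s) = fun=> 0.
    by apply/funext => s; rewrite big_nil.
  exact: is_cder_cst.
rewrite big_cons; have -> : (fun s => \sum_(i <- i :: r) phi i s) =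
    fun s => phi i s + \sum_(i <- r) phi i s.
  by apply/funext => s; rewrite big_cons.
exact: is_cderD.
Qed.

Lemma is_cder_id t : is_cder (real_complex R) t 1.
Proof. by split; [exact: is_derive_id|exact: is_derive_cst]. Qed.

Lemma is_cder_div phi t l : t != 0 -> is_cder phi t l ->
  is_cder (fun s => phi s / s%:C) t ((t%:C * l - phi t) / t%:C ^+ 2).
Proof.
move=> t0 [pr pi].
have E (z : R[i]) (e : R) :
    z / e%:C = (complex.Re z / e) +i* (complex.Im z / e).
  by rewrite -realCV; case: z => x y /=; simpc.
have V : is_derive t (1 : R) (fun s : R => s^-1) (- t ^- 2 *: 1).
  exact: (@is_deriveV R id t 1 1).
have ReE : (t%:C * l - phi t) / t%:C ^+ 2 =
   ((t * complex.Re l - complex.Re (phi t)) / t ^+ 2) +i*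
   ((t * complex.Im l - complex.Im (phi t)) / t ^+ 2).
  rewrite -rmorphXn E; case: (l) => x y; case: (phi t) => x' y' /=.
  by rewrite !mul0r subr0 addr0.
rewrite ReE; split => /=.
  have := is_deriveM pr V.
  have -> : complex.Re (phi t) *: (- t ^- 2 *: (1 : R)) + t^-1 *: complex.Re l =
    (t * complex.Re l - complex.Re (phi t)) / t ^+ 2.
    by rewrite /GRing.scale /=; field.
  by congr is_derive; apply/funext => s; rewrite E.
have := is_deriveM pi V.
have -> : complex.Im (phi t) *: (- t ^- 2 *: (1 : R)) + t^-1 *: complex.Im l =
    (t * complex.Im l - complex.Im (phi t)) / t ^+ 2.
  by rewrite /GRing.scale /=; field.
by congr is_derive; apply/funext => s; rewrite E.
Qed.

(* Rotating the increment onto the positive real axis reduces the claim to the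
   mean value theorem for a real part. *)
Lemma cmean_value phi (dphi : R -> R[i]) a b (K : R) : a <= b ->
  (forall t, a <= t <= b -> is_cder phi t (dphi t)) ->
  (forall t, a <= t <= b -> rnorm (dphi t) <= K) ->
  rnorm (phi b - phi a) <= K * (b - a).
Proof.
move=> ab dp pK; set w := phi b - phi a.
have K0 : 0 <= K by apply: le_trans (rnorm_ge0 _) (pK a _); rewrite lexx.
have [->|w0] := eqVneq w 0; first by rewrite rnorm0 mulr_ge0 ?subr_ge0.
have rw0 : 0 < rnorm w by rewrite rnorm_gt0.
(* The conjugate is left unnormalised: the increment of the rotated function is then |w|^2, and one
   factor |w| is cancelled at the end. *)
pose u := w^*.
have uw : u * w = (rnorm w ^+ 2)%:C.
  by rewrite rmorphXn/= -rnormE sqr_normc mulrC.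
have nu : rnorm u = rnorm w by rewrite /rnorm normcJ.
have dup t : a <= t <= b -> is_derive t 1 (fun s => complex.Re (u * phi s))
    (complex.Re (u * dphi t)).
  by move=> /dp /(is_cderZ u) [].
have cont : {within `[a, b], continuous (fun s => complex.Re (u * phi s))}.
  by apply: derivable_within_continuous => x; rewrite in_itv/= => /dup[].
have [|c] := MVT_segment ab _ cont (df := fun t => complex.Re (u * dphi t)).
  move=> x; rewrite in_itv/= => /andP[ax xb]; apply: dup.
  by rewrite !ltW.
rewrite in_itv/= => /pK cK.
rewrite -(raddfB (@complex.Re R)) -mulrBr -/w uw /= => E.
rewrite -(ler_pM2l rw0) -expr2 E mulrA ler_wpM2r ?subr_ge0//.
apply: le_trans (ler_norm _) _; apply: le_trans (Re_le_rnorm _) _.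
by rewrite rnormM nu ler_wpM2l ?rnorm_ge0.
Qed.

(** The mean value inequality for [phi s - l * s]. The bounds [Num.min] and [Num.max] admit b < a,
    as increments of difference quotients have either sign. *)
Lemma cmean_value_dist phi (dphi : R -> R[i]) a b l (K : R) :
  (forall t, Num.min a b <= t <= Num.max a b -> is_cder phi t (dphi t)) ->
  (forall t, Num.min a b <= t <= Num.max a b -> rnorm (dphi t - l) <= K) ->
  rnorm (phi b - phi a - (b - a)%:C * l) <= K * `|b - a|.
Proof.
move=> dp pK; pose psi s := phi s + (- l) * s%:C.
have E c d : phi d - phi c - (d - c)%:C * l = psi d - psi c.
  by rewrite /psi realCB; ring.
have dpsi t : Num.min a b <= t <= Num.max a b -> is_cder psi t (dphi t - l).
  move=> /dp dt; have := is_cderD dt (is_cderZ (- l) (is_cder_id t)).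
  by rewrite mulr1.
have [ab|/ltW ba] := leP a b.
  rewrite E ger0_norm ?subr_ge0//; move: dpsi pK.
  by rewrite min_l ?max_r//; exact: cmean_value.
rewrite E rnorm_distC ler0_norm ?subr_le0// opprB; move: dpsi pK.
by rewrite min_r ?max_l//; exact: cmean_value.
Qed.

End ComplexValuedDerivative.

(** * Uniform continuity on compact sets; compactness of discs *)

Section UniformContinuity.
Context {R : realType}.

(** Near x, [delta] is at most half the radius e at which [h] is within eps/2 of h(x): if z is
    within e/2 of x, then w is within e of x. Compactness makes [delta] uniform in x. *)
Lemma compact_uniform_continuity (V : normedModType R[i]) (K : set V)
    (h : V -> R[i]) (eps : R) : compact K ->
  (forall z, K z -> {for z, continuous h}) -> 0 < eps ->
  exists2 delta : R, 0 < delta & forall z w, K z -> rnorm (w - z) < delta ->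
    rnorm (h w - h z) < eps.
Proof.
move=> /compact_near_coveringP cK hc eps0.
have : \forall d \near (0 : R)^'+, K `<=`
    [set z | forall w, rnorm (w - z) < d -> rnorm (h w - h z) < eps].
  apply: (cK _ _ (fun d z => forall w, rnorm (w - z) < d ->
    rnorm (h w - h z) < eps)) => x Kx.
  have /cvg_rnormP /(_ (eps / 2)) := hc x Kx.
  have e2 : 0 < eps / 2 by rewrite divr_gt0.
  move=> /(_ e2) /nbhs_rnormP[e e0 he].
  exists ([set y | rnorm (y - x) < e / 2], [set d | d < e / 2]) => /=.
    split; first by apply/nbhs_rnormP; exists (e / 2); rewrite ?divr_gt0.
    by apply: nbhs_right_lt; rewrite divr_gt0.
  move=> [z d] /= [zx de] w wz.
  have zE : rnorm (h z - h x) < eps / 2 by apply: he; lra.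
  have wE : rnorm (h w - h x) < eps / 2.
    by apply: he; have := rnorm_distD z w x; lra.
  have := rnorm_distD (h x) (h w) (h z).
  by rewrite [rnorm (h x - _)]rnorm_distC; lra.
move=> H; have : \forall d \near (0 : R)^'+, 0 < d by exact: nbhs_right_gt.
move=> /(filterI H) /filter_ex[d [Kd d0]].
by exists d => // z w Kz; exact: Kd.
Qed.

(** The disc is a closed subset of the continuous image of a square. *)
Lemma compact_disc (r : R) : compact [set z : R[i] | rnorm z <= r].
Proof.
pose sq := `[- r, r]%classic `*` `[- r, r]%classic.
pose f (p : R * R) := p.1 +i* p.2.
apply: (@subclosed_compact _ _ (f @` sq)).
- rewrite -[X in closed X]setCK; apply: open_closedC; rewrite openE => z /=.
  move=> /negP; rewrite -ltNge => rz; apply/nbhs_rnormP.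
  exists (rnorm z - r); first by rewrite subr_gt0.
  move=> y yz; apply/negP; rewrite -ltNge.
  have := rnorm_distD y z 0; rewrite !subr0 [rnorm (z - y)]rnorm_distC; lra.
- apply: continuous_compact; last first.
    by apply: compact_setX; exact: segment_compact.
  apply: continuous_subspaceT => -[x y]; apply/cvg_rnormP => e e0.
  have e2 : 0 < e / 2 by rewrite divr_gt0.
  exists (ball x (e / 2), ball y (e / 2)) => /=.
    by split; exact: nbhsx_ballx.
  move=> [x' y'] /= []; rewrite -!ball_normE /= => xx yy.
  apply: le_lt_trans (rnorm_le_ReIm _) _ => /=.
  by move: xx yy; rewrite (distrC x) (distrC y); lra.
- move=> z /= zr; exists (complex.Re z, complex.Im z); last by case: (z).
  by split => /=; rewrite in_itv/= -ler_norml;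
    [apply: le_trans (Re_le_rnorm _) zr|apply: le_trans (Im_le_rnorm _) zr].
Qed.

End UniformContinuity.

(** * Roots of unity close to 1 *)

Section RootsOfUnity.
Context {R : realType}.

Let cis (x : R) : R[i] := cos x +i* sin x.

Let cisD x y : cis (x + y) = cis x * cis y.
Proof. by rewrite /cis cosD sinD; simpc; rewrite [sin x * _ + _]addrC. Qed.

Let cisMn x n : cis (x *+ n) = cis x ^+ n.
Proof.
elim: n => [|n IH]; first by rewrite mulr0n /cis cos0 sin0 expr0.
by rewrite mulrS exprS cisD IH.
Qed.

(** The root is exp(i pi/(n+1)) for large n. Its power n+1 is -1, which yields both w^(2(n+1)) = 1
    and w != 1. *)
Lemma root_of_unity_near1 (delta : R) : 0 < delta ->
  exists (n : nat) (w : R[i]),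
    [/\ (0 < n)%N, w ^+ n = 1, w != 1, rnorm w = 1 & rnorm (w - 1) < delta].
Proof.
move=> d0; have d2 : 0 < delta / 2 by rewrite divr_gt0.
have cos1 : cos x @[x --> (0 : R)] --> (1 : R).
  by rewrite -[X in _ --> X]cos0; exact: continuous_cos.
have sin1 : sin x @[x --> (0 : R)] --> (0 : R).
  by rewrite -[X in _ --> X]sin0; exact: continuous_sin.
have /nbhs_ballP[e /= e0 he] : \forall x \near (0 : R),
    `|1 - cos x| < delta / 2 /\ `|0 - sin x| < delta / 2.
  apply: filterI; first by move/cvgrPdist_lt: cos1; apply.
  by move/cvgrPdist_lt: sin1; apply.
pose n := Num.truncn (pi / e).
have xe : pi / n.+1%:R < e :> R.
  by rewrite ltr_pdivrMr// mulrC -ltr_pdivrMr// truncnS_gt.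
pose x : R := pi / n.+1%:R.
have xpi : cis x ^+ n.+1 = -1.
  rewrite -cisMn -mulr_natr mulfVK ?pnatr_eq0// /cis cospi sinpi.
  by apply/eqP; rewrite eq_complex /= oppr0 !eqxx.
exists (n.+1 * 2)%N, (cis x); split => //.
- by rewrite exprM xpi sqrrN expr1n.
- apply/eqP => x1; move: xpi; rewrite x1 expr1n => /eqP.
  by rewrite -subr_eq0 opprK (_ : 1 + 1 = 2%:R)// pnatr_eq0.
- by rewrite /rnorm normc_def /= cos2Dsin2 sqrtr1.
- apply: le_lt_trans (rnorm_le_ReIm _) _ => /=; rewrite oppr0 addr0.
  have /he[] : ball (0 : R) e x.
    by rewrite -ball_normE /= sub0r normrN ger0_norm// divr_ge0// pi_ge0.
  by rewrite distrC sub0r normrN; lra.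
Qed.

End RootsOfUnity.

(** * Cauchy's estimate *)

Section CauchyEstimate.
Context {R : realType}.
Variables (g g' : R[i] -> R[i]) (r : R).
Hypothesis r_gt0 : 0 < r.
(** Complex differentiability on the closed disc, tested along real lines: linearity in the complex
    direction [w] encodes the Cauchy-Riemann equations. *)
Hypothesis g_deriv : forall (z w : R[i]) (t : R), rnorm (z + t%:C * w) <= r ->
  is_cder (fun s : R => g (z + s%:C * w)) t (g' (z + t%:C * w) * w).
Hypothesis g'_cont : forall z, rnorm z <= r -> {for z, continuous g'}.

(** By convexity the chord from [a] to [b] stays in the disc, and its points are no farther from [a]
    than [b] is; the mean value estimate applies along it. *)
Lemma chord_estimate (a b l : R[i]) (K : R) :
  rnorm a <= r -> rnorm b <= r ->
  (forall z, rnorm z <= r -> rnorm (z - a) <= rnorm (b - a) ->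
    rnorm (g' z - l) <= K) ->
  rnorm (g b - g a - (b - a) * l) <= K * rnorm (b - a).
Proof.
move=> ar br gK.
have seg (t : R) : 0 <= t <= 1 -> rnorm (a + t%:C * (b - a)) <= r /\
    rnorm (a + t%:C * (b - a) - a) <= rnorm (b - a).
  move=> /andP[t0 t1]; split.
    have -> : a + t%:C * (b - a) = (1 - t)%:C * a + t%:C * b.
      by rewrite realCB; ring.
    apply: le_trans (rnormD _ _) _; rewrite !rnormM !rnormC.
    by rewrite !ger0_norm ?subr_ge0//; nra.
  by rewrite addrAC subrr add0r rnormM rnormC ger0_norm// ler_piMl// rnorm_ge0.
have := @cmean_value_dist _ (fun s : R => g (a + s%:C * (b - a)))
  (fun s : R => g' (a + s%:C * (b - a)) * (b - a)) 0 1 ((b - a) * l)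
  (K * rnorm (b - a)).
rewrite min_l ?max_r//= subr0 normr1 mulr1 mul1r mul0r addr0 mul1r.
rewrite [a + _]addrC subrK; apply.
  by move=> t /seg[tr _]; exact: g_deriv.
move=> t /seg[tr ta]; rewrite -[(b - a) * l]mulrC -mulrBl rnormM.
by rewrite ler_wpM2r ?rnorm_ge0// gK.
Qed.

Section Averages.
Variables (n : nat) (w : R[i]) (eps : R).
Hypotheses (wn1 : w ^+ n = 1) (w_neq1 : w != 1) (nw : rnorm w = 1).
Hypothesis g'_osc : forall z z', rnorm z <= r -> rnorm z' <= r ->
  rnorm (z' - z) <= r * rnorm (w - 1) -> rnorm (g' z' - g' z) <= eps.

Let w_neq0 : w != 0.
Proof. by rewrite -rnorm_gt0 nw. Qed.

Let nwX k : rnorm (w ^+ k) = 1.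
Proof. by rewrite rnormX nw expr1n. Qed.

(** A discrete Cauchy integral: [G s / s] is the sum of g(z)/z over the points z = s w^k, expected
    to be close to [n * g' 0]. [dG] is the derivative of [G]. *)
Let G (s : R) := \sum_(0 <= k < n) w ^- k * g (s%:C * w ^+ k).
Let dG (s : R) := \sum_(0 <= k < n) g' (s%:C * w ^+ k).

Let circle_le (s : R) k : 0 <= s <= r -> rnorm (s%:C * w ^+ k) <= r.
Proof. by move=> /andP[s0 sr]; rewrite rnormM nwX mulr1 rnormC ger0_norm. Qed.

Let G_deriv (s : R) : 0 <= s <= r -> is_cder G s (dG s).
Proof.
move=> sr; apply: is_cder_sum => k.
have := @g_deriv 0 (w ^+ k) s; rewrite add0r => /(_ (circle_le k sr)).
have -> : (fun s : R => g (0 + s%:C * w ^+ k)) = fun s => g (s%:C * w ^+ k).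
  by apply/funext => x; rewrite add0r.
move=> /(is_cderZ (w ^- k)); rewrite mulrCA mulVf ?mulr1//.
by rewrite expf_neq0.
Qed.

(* The sum of w^-(k+1) g(s w^(k+1)) - w^-k g(s w^k) over a period telescopes
   to 0, while each term is close to
   w^-(k+1) (w - 1) (s w^k g'(s w^k) - g(s w^k)). *)
Let G_almost_linear (s : R) : 0 <= s <= r ->
  rnorm (s%:C * dG s - G s) <= n%:R * eps * s.
Proof.
move=> /[dup] sr /andP[s0 sr'].
have w10 : 0 < rnorm (w - 1) by rewrite rnorm_gt0 subr_eq0.
pose F k := w ^- k * g (s%:C * w ^+ k).
pose err k := g (s%:C * w ^+ k.+1) - g (s%:C * w ^+ k) -
  (s%:C * w ^+ k.+1 - s%:C * w ^+ k) * g' (s%:C * w ^+ k).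
(* The factor [w] turns the weight w^-(k+1) into w^-k, the weight of [err k] in [E]. *)
have F0 : \sum_(0 <= k < n) w * (F k.+1 - F k) = 0.
  by rewrite -mulr_sumr telescope_sumr// /F wn1 expr0 subrr mulr0.
have E : (w - 1) * (s%:C * dG s - G s) = - \sum_(0 <= k < n) w ^- k * err k.
  apply/eqP; rewrite -addr_eq0 -[X in _ == X]F0; apply/eqP.
  rewrite /G /dG mulr_sumr -sumrB mulr_sumr -big_split /=.
  apply: eq_bigr => k _; rewrite /F /err exprS.
  have : w ^+ k != 0 by rewrite expf_neq0.
  by move: (w ^+ k) w_neq0 => v w0 v0; field; rewrite w0 v0.
(* All chords have length s|w - 1|, so every error term carries a factor |w - 1|, which cancels. *)
suff : rnorm (w - 1) * rnorm (s%:C * dG s - G s) <=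
    rnorm (w - 1) * (n%:R * eps * s) by rewrite ler_pM2l.
rewrite -rnormM E rnormN.
apply: le_trans (rnorm_sum _ _) _.
have -> : rnorm (w - 1) * (n%:R * eps * s) =
    \sum_(0 <= k < n) (eps * (s * rnorm (w - 1))).
  by rewrite sumr_const_nat subn0 -[RHS]mulr_natl; ring.
apply: ler_sum => k _; rewrite rnormM rnormV nwX invr1 mul1r.
have step : rnorm (s%:C * w ^+ k.+1 - s%:C * w ^+ k) = s * rnorm (w - 1).
  rewrite exprSr -mulrBr -[X in _ - X]mulr1 -mulrBr !rnormM nwX mul1r.
  by rewrite rnormC ger0_norm.
rewrite -step; apply: chord_estimate; try exact: circle_le.
move=> z zr; rewrite step => zs; apply: g'_osc; rewrite ?circle_le//.
by apply: le_trans zs _; rewrite ler_wpM2r// ltW.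
Qed.

(** The derivative (s dG(s) - G(s))/s^2 of G(s)/s is at most n eps/s, hence at most n eps/d on
    [d, r]. *)
Lemma weighted_average_variation (d : R) : 0 < d <= r ->
  rnorm (G r / r%:C - G d / d%:C) <= n%:R * eps * r / d.
Proof.
move=> /andP[d0 dr].
have eps0 : 0 <= eps.
  apply: le_trans (rnorm_ge0 (g' 0 - g' 0)) _.
  by apply: g'_osc; rewrite ?subrr ?rnorm0 ?mulr_ge0 ?rnorm_ge0// ltW.
have bnd (t : R) : d <= t <= r -> 0 < t /\ 0 <= t <= r.
  move=> /andP[dt tr]; have t0 := lt_le_trans d0 dt.
  by rewrite t0 (ltW t0) tr.
apply: (@le_trans _ _ (n%:R * eps / d * (r - d))); last first.
  rewrite mulrAC ler_pM2r ?invr_gt0// ler_wpM2l ?mulr_ge0//.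
  by rewrite lerBlDr lerDl ltW.
apply: (@cmean_value _ (fun s => G s / s%:C)
  (fun s => (s%:C * dG s - G s) / s%:C ^+ 2)) => //
  t /[dup] /andP[dt _] /bnd[t0 tr].
  by apply: is_cder_div; [rewrite gt_eqF|exact: G_deriv].
rewrite rnormM rnormV rnormX rnormC (gtr0_norm t0) ler_pdivrMr ?exprn_gt0//.
apply: le_trans (G_almost_linear tr) _.
have -> : n%:R * eps / d * t ^+ 2 = n%:R * eps * t * (t / d) by ring.
by rewrite ler_peMr ?mulr_ge0 ?mulr_ge0 ?(ltW t0)// ler_pdivlMr// mul1r.
Qed.

Let sum_wN : \sum_(0 <= k < n) w ^- k = 0.
Proof.
have w1 : w^-1 - 1 != 0 by rewrite subr_eq0 invr_eq1.
apply: (mulfI w1); rewrite mulr0 mulr_sumr.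
rewrite (eq_bigr (fun k => w ^- k.+1 - w ^- k)) => [|k _].
  by rewrite telescope_sumr// wn1 expr0 subrr.
by rewrite exprS invfM; ring.
Qed.

(** Since the powers w^-k sum to 0, [g 0] can be subtracted from every value of [g]; the chord from
    0 to d w^k then contributes [g' 0] up to [eta]. *)
Lemma small_circle_average (d eta : R) : 0 < d <= r ->
  (forall z, rnorm z <= d -> rnorm (g' z - g' 0) <= eta) ->
  rnorm (G d / d%:C - n%:R * g' 0) <= n%:R * eta.
Proof.
move=> /andP[d0 dr] g'eta.
have dC0 : d%:C != 0 by rewrite -rnorm_gt0 rnormC gtr0_norm.
have -> : G d / d%:C - n%:R * g' 0 = \sum_(0 <= k < n)
    w ^- k / d%:C * (g (d%:C * w ^+ k) - g 0 - (d%:C * w ^+ k - 0) * g' 0).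
  transitivity (G d / d%:C - n%:R * g' 0 -
      (\sum_(0 <= k < n) w ^- k) * (g 0 / d%:C)).
    by rewrite sum_wN mul0r subr0.
  have -> : n%:R * g' 0 = \sum_(0 <= k < n) g' 0.
    by rewrite sumr_const_nat subn0 mulr_natl.
  rewrite /G !mulr_suml -!sumrB; apply: eq_bigr => k _.
  have : w ^+ k != 0 by rewrite expf_neq0.
  by move: (w ^+ k) => v v0; field; rewrite v0 dC0.
apply: le_trans (rnorm_sum _ _) _.
have -> : n%:R * eta = \sum_(0 <= k < n) eta.
  by rewrite sumr_const_nat subn0 mulr_natl.
apply: ler_sum => k _.
have dk : rnorm (d%:C * w ^+ k) = d.
  by rewrite rnormM nwX mulr1 rnormC gtr0_norm.
rewrite !rnormM !rnormV nwX invr1 mul1r rnormC gtr0_norm// mulrC.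
rewrite ler_pdivrMr//.
have := @chord_estimate 0 (d%:C * w ^+ k) (g' 0) eta.
rewrite subr0 dk rnorm0; apply=> //; first exact: ltW.
by move=> z _; rewrite subr0; exact: g'eta.
Qed.

(** Triangle inequality from n g'(0) through G(d)/d to G(r)/r, the last being at most n M/r; then
    division by [n]. *)
Lemma derivative_bound_averages (d eta M : R) : (0 < n)%N -> 0 < d <= r ->
  (forall z, rnorm z <= d -> rnorm (g' z - g' 0) <= eta) ->
  (forall z, rnorm z <= r -> rnorm (g z) <= M) ->
  rnorm (g' 0) <= M / r + eta + eps * r / d.
Proof.
move=> n0 dr g'eta gM.
have H1 := small_circle_average dr g'eta.
have H2 := weighted_average_variation dr.
have H3 : rnorm (G r / r%:C) <= n%:R * (M / r).
  rewrite rnormM rnormV rnormC (gtr0_norm r_gt0) mulrA ler_pM2r ?invr_gt0//.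
  apply: le_trans (rnorm_sum _ _) _.
  have -> : n%:R * M = \sum_(0 <= k < n) M.
    by rewrite sumr_const_nat subn0 mulr_natl.
  apply: ler_sum => k _; rewrite rnormM rnormV nwX invr1 mul1r gM//.
  by rewrite circle_le// lexx ltW.
have nR : 0 < n%:R :> R by rewrite ltr0n.
have nC : rnorm (n%:R : R[i]) = n%:R.
  by rewrite -(rmorph_nat (real_complex R)) rnormC gtr0_norm.
suff : n%:R * rnorm (g' 0) <= n%:R * (M / r + eta + eps * r / d).
  by rewrite ler_pM2l.
rewrite -nC -rnormM nC.
have := rnorm_distD (G d / d%:C) (n%:R * g' 0) 0.
have := rnorm_distD (G r / r%:C) (G d / d%:C) 0.
rewrite !subr0 [rnorm (_ - G d / _)]rnorm_distC.
rewrite [rnorm (G d / _ - G r / _)]rnorm_distC.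
have -> : n%:R * (M / r + eta + eps * r / d) =
  n%:R * (M / r) + n%:R * eta + n%:R * eps * r / d by ring.
lra.
Qed.

End Averages.

(** The order of choices matters: [d] by continuity of [g'] at 0, then [eps] depending on [d], then
    [delta] by uniform continuity of [g'] on the disc, and finally [w]. *)
Lemma cauchy_estimate (M : R) : (forall z, rnorm z <= r -> rnorm (g z) <= M) ->
  rnorm (g' 0) <= M / r.
Proof.
move=> gM; apply/ler_addgt0Pr => e e0.
have e2 : 0 < e / 2 by rewrite divr_gt0.
have r0 : rnorm (0 : R[i]) <= r by rewrite rnorm0 ltW.
have /cvg_rnormP/(_ _ e2)/nbhs_rnormP[d0 d00 hd0] := g'_cont r0.
pose d := Num.min (d0 / 2) r.
have d_gt0 : 0 < d by rewrite lt_min r_gt0 divr_gt0.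
have dd0 : d < d0.
  by rewrite gt_min ltr_pdivrMr// mulr2n mulrDr mulr1 ltrDl d00.
have dr : d <= r by rewrite ge_min lexx orbT.
(* This makes the error term [eps * r / d] equal to e/2; the other one, [eta], is e/2 as well. *)
pose eps := e / 2 * d / r.
have eps0 : 0 < eps by rewrite divr_gt0// mulr_gt0.
have [delta delta0 osc] :=
  compact_uniform_continuity (@compact_disc R r) g'_cont eps0.
(* On the circle of radius [r], consecutive points s w^k are r|w - 1| apart, so |w - 1| must be
   below delta/r. *)
have dr0 : 0 < delta / r by rewrite divr_gt0.
have [n [w [n0 wn w1 nw wd]]] := root_of_unity_near1 dr0.
have /(_ eps) := derivative_bound_averages wn w1 nw.
move=> /(_ _ d (e / 2) M n0) H.
have -> : M / r + e = M / r + e / 2 + eps * r / d.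
  by rewrite /eps; field; rewrite !gt_eqF.
apply: H => //; last 1 first.
- by move=> z zd; apply/ltW/hd0; rewrite subr0 (le_lt_trans zd).
- move=> z z' zr _ zz; apply/ltW/osc => //.
  by apply: le_lt_trans zz _; rewrite mulrC -ltr_pdivlMr.
- by rewrite d_gt0.
Qed.

End CauchyEstimate.

(** * Holomorphic functions on a normed space *)

Section DirectionalDerivative.
Context {R : realType} {X : normedModType R[i]}.
Variables (Omega : set X) (u : X -> R[i]).
Hypotheses (oOmega : open Omega) (uC1 : C1_on Omega u).
Implicit Types (q v w : X) (t : R).

Lemma du_cvg q v : Omega q ->
  diff_quotient u q v e @[e --> 0^'] --> du u q v.
Proof. by move=> Oq; apply: (uC1.1 q v Oq). Qed.

Lemma is_cder_line q v t : Omega (q + t%:C *: v) ->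
  is_cder (fun s : R => u (q + s%:C *: v)) t (du u (q + t%:C *: v) v).
Proof.
move=> /(@du_cvg _ v) => H; apply: is_cder_cvg_quot.
have -> : (fun e => (u (q + (t + e)%:C *: v) - u (q + t%:C *: v)) / e%:C) =
    diff_quotient u (q + t%:C *: v) v.
  by apply/funext => e; rewrite realCD scalerDl addrA.
exact: H.
Qed.

Lemma du_continuous q v : Omega q -> {for q, continuous (fun p => du u p v)}.
Proof.
move=> Oq; have := uC1.2; rewrite continuous_open_subspace; last first.
  rewrite openE => -[x y] /= [Ox _]; exists (Omega, setT) => /=.
    by split; [exact: open_nbhs_nbhs|exact: filterT].
  by move=> [x' y'] [].
move=> /(_ (q, v)); rewrite inE /= => /(_ (conj Oq I)) H.
apply: (@continuous_comp _ _ _ (fun p : X => (p, v))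
  (fun p : X * X => du u p.1 p.2)) => //.
by apply: cvg_pair; [exact: cvg_id|exact: cvg_cst].
Qed.

Lemma du_realZ q v (a : R) : Omega q -> du u q (a%:C *: v) = a%:C * du u q v.
Proof.
move=> Oq; apply: cvg_lim => //.
have [->|a0] := eqVneq a 0.
  rewrite mul0r; apply: cvg_near_cst; near=> e.
  by rewrite /diff_quotient scale0r scaler0 addr0 subrr mul0r.
have na : 0 < `|a| by rewrite normr_gt0.
apply/cvg_rnormP => eps eps0.
have /cvg_rnormP/(_ (eps / `|a|)) := @du_cvg q v Oq.
rewrite divr_gt0// => /(_ isT) [d /= d0 hd].
exists (d / `|a|); first exact: divr_gt0.
move=> e /=; rewrite sub0r normrN ltr_pdivlMr// -normrM => ea e0.
have /= := hd (e * a); rewrite sub0r normrN mulf_neq0// => /(_ ea isT).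
rewrite ltr_pdivlMr// -(rnormC a) -rnormM; congr (rnorm _ < _).
rewrite /diff_quotient scalerA realCM.
have aC : a%:C != 0 by rewrite -rnorm_gt0 rnormC.
have eC : e%:C != 0 by rewrite -rnorm_gt0 rnormC normr_gt0.
by field; rewrite aC eC.
Unshelve. all: by end_near. Qed.

(** The increment along v + w passes through q + e v. Its second half is a quotient at that moving
    point; the mean value estimate and continuity of [du u p w] in p compare it with [du u q w]. *)
Lemma duD q v w : Omega q -> du u q (v + w) = du u q v + du u q w.
Proof.
move=> Oq; apply: cvg_lim => //; apply/cvg_rnormP => eps eps0.
have e2 : 0 < eps / 2 by rewrite divr_gt0.
have /cvg_rnormP/(_ _ e2) Hv := @du_cvg q v Oq.
have /cvg_rnormP/(_ (eps / 4)) := @du_continuous q w Oq.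
rewrite divr_gt0// => /(_ isT).
move=> /(filterI (open_nbhs_nbhs (conj oOmega Oq))) /nbhs_rnormP[d d0 hd].
(* This keeps q + e v + t w, for t between 0 and e, in the ball where [du] is controlled. The [+ 1]
   below covers v = w = 0. *)
have : \forall e \near (0 : R)^', `|e| * (rnorm v + rnorm w) < d.
  have c0 : 0 < d / (rnorm v + rnorm w + 1).
    by rewrite divr_gt0// ltr_wpDl// addr_ge0 ?rnorm_ge0.
  exists (d / (rnorm v + rnorm w + 1)) => // e /=.
  rewrite sub0r normrN ltr_pdivlMr ?ltr_wpDl ?addr_ge0 ?rnorm_ge0// => + _.
  by apply: le_lt_trans; rewrite ler_wpM2l// lerDl.
move=> Hd; have e_neq0 : \forall e \near (0 : R)^', e != 0.
  exact: nbhs_dnbhs_neq.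
near=> e; have e0 : e != 0 by near: e.
have eC : e%:C != 0 by rewrite -rnorm_gt0 rnormC normr_gt0.
have vE : rnorm (diff_quotient u q v e - du u q v) < eps / 2 by near: e.
have ed : `|e| * (rnorm v + rnorm w) < d by near: e.
have seg (t : R) : Num.min 0 e <= t <= Num.max 0 e ->
    rnorm (q + e%:C *: v + t%:C *: w - q) < d.
  move=> te; have {}te : `|t| <= `|e|.
    move: te; have [e_ge|e_le] := leP 0 e => /andP[t1 t2].
      by rewrite !ger0_norm.
    by rewrite !ler0_norm ?lerN2 ?(ltW e_le).
  rewrite -[q + _ + _]addrA [q + _]addrC addrK; apply: le_lt_trans ed.
  apply: le_trans (rnormD _ _) _; rewrite !rnorm_scale !rnormC mulrDr lerD2l.
  by rewrite ler_wpM2r ?rnorm_ge0.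
have := @cmean_value_dist _ (fun s : R => u (q + e%:C *: v + s%:C *: w))
  (fun s : R => du u (q + e%:C *: v + s%:C *: w) w) 0 e (du u q w) (eps / 4).
rewrite subr0 scale0r addr0 => H.
have {}H : rnorm (u (q + e%:C *: v + e%:C *: w) - u (q + e%:C *: v) -
    e%:C * du u q w) <= eps / 4 * `|e|.
  apply: H => t /seg /hd[Ot /ltW//].
  by move=> _; exact: is_cder_line.
have wE : rnorm (diff_quotient u (q + e%:C *: v) w e - du u q w) <= eps / 4.
  rewrite -(ler_pM2r (_ : 0 < `|e|)) ?normr_gt0//.
  apply: le_trans H; rewrite -(rnormC e) -rnormM.
  suff -> : (diff_quotient u (q + e%:C *: v) w e - du u q w) * e%:C =
    u (q + e%:C *: v + e%:C *: w) - u (q + e%:C *: v) - e%:C * du u q w by [].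
  by rewrite /diff_quotient; field.
have -> : diff_quotient u q (v + w) e - (du u q v + du u q w) =
  (diff_quotient u q v e - du u q v) +
  (diff_quotient u (q + e%:C *: v) w e - du u q w).
  by rewrite /diff_quotient scalerDr addrA; field.
apply: le_lt_trans (rnormD _ _) _; lra.
Unshelve. all: by end_near. Qed.

Hypothesis Dbar0 : forall q v, Omega q -> Dbar u q v = 0.

(** The equation [Dbar u = 0] says that [du] commutes with multiplication by i; real linearity gives
    the rest. *)
Lemma duZ q v (z : R[i]) : Omega q -> du u q (z *: v) = z * du u q v.
Proof.
move=> Oq; have iv : du u q ('i *: v) = 'i * du u q v.
  have := Dbar0 v Oq; rewrite /Dbar => /eqP; rewrite mulf_eq0 invr_eq0.
  rewrite pnatr_eq0 /= => /eqP H.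
  have ii : 'i * 'i = -1 :> R[i] by rewrite -expr2 sqr_i.
  have ib : 'i * du u q ('i *: v) = - du u q v.
    by apply/eqP; rewrite -addr_eq0 addrC H.
  transitivity (- ('i * ('i * du u q ('i *: v)))).
    by rewrite mulrA ii mulN1r opprK.
  by rewrite ib mulrN opprK.
have zE : z *: v = (complex.Re z)%:C *: v + (complex.Im z)%:C *: ('i *: v).
  by rewrite scalerA [_ * 'i]mulrC -scalerDl -complexE.
rewrite zE duD// !du_realZ// iv {3}[z]complexE.
by rewrite mulrDl mulrA [_ * 'i]mulrC.
Qed.

(** Cauchy's estimate for z |-> u(q + z v); complex linearity of [du] supplies the hypothesis
    [g_deriv]. *)
Lemma du_bound q v (r M : R) : 0 < r ->
  (forall z : R[i], rnorm z <= r -> Omega (q + z *: v)) ->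
  (forall z : R[i], rnorm z <= r -> rnorm (u (q + z *: v)) <= M) ->
  rnorm (du u q v) <= M / r.
Proof.
move=> r0 Or uM.
have := @cauchy_estimate _ (fun z => u (q + z *: v))
  (fun z => du u (q + z *: v) v) r r0.
rewrite scale0r addr0; apply=> // [z w t zr|z zr].
  have E (s : R) : q + (z + s%:C * w) *: v = q + z *: v + s%:C *: (w *: v).
    by rewrite scalerDl scalerA addrA.
  have -> : (fun s : R => u (q + (z + s%:C * w) *: v)) =
      fun s => u (q + z *: v + s%:C *: (w *: v)).
    by apply/funext => s; rewrite E.
  rewrite mulrC -duZ; last exact: Or.
  by rewrite E; apply: is_cder_line; rewrite -E; exact: Or.
apply: (@continuous_comp _ _ _ (fun z : R[i] => q + z *: v)
  (fun p : X => du u p v)); last exact/du_continuous/Or.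
apply/(cvg_rnormP (nbhs_filter z)) => e e0; apply/nbhs_rnormP.
exists (e / (rnorm v + 1)) => [|y].
  by rewrite divr_gt0// ltr_wpDl ?rnorm_ge0.
rewrite opprD addrACA subrr add0r -scalerBl rnorm_scale.
rewrite ltr_pdivlMr ?ltr_wpDl ?rnorm_ge0//; apply: le_lt_trans.
by rewrite ler_wpM2l ?rnorm_ge0// lerDl.
Qed.

(** Around each point of the segment from x to y, the disc of radius r/|v| in direction v = y - x
    stays in the ball of radius 2r. Hence [du] along v is at most M|v|/r, and the mean value
    inequality concludes. *)
Lemma bounded_lipschitz (p : X) (r M : R) : 0 < r ->
  (forall y, rnorm (y - p) < 2 * r -> Omega y) ->
  (forall y, rnorm (y - p) < 2 * r -> rnorm (u y) <= M) ->
  forall x y, rnorm (x - p) < r -> rnorm (y - p) < r ->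
    rnorm (u y - u x) <= M / r * rnorm (y - x).
Proof.
move=> r0 Op uM x y xp yp.
have [->|yx] := eqVneq y x; first by rewrite !subrr !rnorm0 mulr0.
set v := y - x; have v0 : 0 < rnorm v by rewrite rnorm_gt0 subr_eq0.
have seg (t : R) : 0 <= t <= 1 -> rnorm (x + t%:C *: v - p) < r.
  move=> /andP[t0 t1].
  have -> : x + t%:C *: v - p = (1 - t)%:C *: (x - p) + t%:C *: (y - p).
    have -> : v = (y - p) - (x - p) by rewrite opprB addrA subrK.
    by rewrite scalerBr realCB scalerBl scale1r addrAC [RHS]addrAC addrA.
  apply: le_lt_trans (rnormD _ _) _; rewrite !rnorm_scale !rnormC.
  rewrite !ger0_norm ?subr_ge0//.
  set m := Num.max (rnorm (x - p)) (rnorm (y - p)).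
  have mr : m < r by rewrite gt_max xp yp.
  have xm : rnorm (x - p) <= m by rewrite le_max lexx.
  have ym : rnorm (y - p) <= m by rewrite le_max lexx orbT.
  by apply: le_lt_trans mr; nra.
have ball2 (t : R) (z : R[i]) : 0 <= t <= 1 -> rnorm z <= r / rnorm v ->
    rnorm (x + t%:C *: v + z *: v - p) < 2 * r.
  move=> /seg tr; rewrite ler_pdivlMr// -rnorm_scale => zr.
  by rewrite addrAC; apply: le_lt_trans (rnormD _ _) _; lra.
have := @cmean_value _ (fun s : R => u (x + s%:C *: v))
  (fun s : R => du u (x + s%:C *: v) v) 0 1 (M / r * rnorm v) ler01.
rewrite scale0r scale1r addr0 subr0 mulr1 [x + v]addrC subrK; apply=> t t01.
  by apply/is_cder_line/Op; apply: lt_trans (seg _ t01) _; lra.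
have -> : M / r * rnorm v = M / (r / rnorm v) by field; rewrite !gt_eqF.
by apply: du_bound; [rewrite divr_gt0|move=> z zr; apply: Op; exact: ball2|
  move=> z zr; apply: uM; exact: ball2].
Qed.

End DirectionalDerivative.

(** * Local boundedness and extraction of subsequences *)

(** A neighbourhood of [p] handles all but finitely many terms; [fin] handles the others by
    induction. *)
Lemma compact_cvg_seq (T : topologicalType) (y : nat -> T) (p : T) :
  y n @[n --> \oo] --> p -> compact ([set p] `|` range y).
Proof.
move=> yp; apply/compact_near_coveringP => J F P FF cov.
have fin N : \forall i \near F, forall n, (n < N)%N -> P i (y n).
  elim: N => [|N IH]; first exact: nearW.
  have [[U V] /= [Uy FV] UV] := cov (y N) (or_intror (ex_intro2 _ _ N I erefl)).
  apply: filterS (filterI IH FV) => i [Pi Vi] n; rewrite ltnS leq_eqVlt.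
  move=> /predU1P[->|]; last exact: Pi.
  by apply: (UV (y N, i)); split => //; exact: nbhs_singleton.
have [[U V] /= [Up FV] UV] := cov p (or_introl erefl).
have /yp[N _ NU] := Up.
apply: filterS (filterI (fin N) FV) => i [Pi Vi] _ [->|[n _ <-]].
  by apply: (UV (p, i)); split => //; exact: nbhs_singleton.
have [nN|Nn] := ltnP n N; first exact: Pi.
by apply: (UV (y n, i)); split => //; exact: NU.
Qed.

Section Sequences.
Context {R : realType}.

Lemma locally_bounded (X : normedModType R[i]) (Omega : set X)
    (F : set (X -> R[i])) (p : X) : open Omega -> bounded_on_compacts Omega F ->
  Omega p -> exists (r M : R), [/\ 0 < r,
    forall y, rnorm (y - p) < r -> Omega y &
    forall y f, rnorm (y - p) < r -> F f -> rnorm (f y) <= M].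
Proof.
move=> oO bF Op.
have /nbhs_rnormP[d d0 dO] := open_nbhs_nbhs (conj oO Op).
apply: contrapT => H.
have /choice[y yP] : forall n : nat, exists y : X,
    rnorm (y - p) < d / n.+1%:R /\ exists2 f, F f & n%:R < rnorm (f y).
  move=> n; apply: contrapT => Hn; apply: H.
  (* If no such point existed, this radius and this bound would contradict [H]. *)
  exists (d / n.+1%:R), n%:R; split; first by rewrite divr_gt0.
    move=> y yd; apply: dO; apply: lt_le_trans yd _.
    by rewrite ler_pdivrMr// ler_peMr ?(ltW d0)// ler1n.
  move=> y f yd Ff; rewrite leNgt; apply/negP => nf; apply: Hn.
  by exists y; split => //; exists f.
have yp : y n @[n --> \oo] --> p.
  apply/cvg_rnormP => e e0.
  exists (Num.truncn (d / e)) => // n /= dn.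
  apply: lt_trans (yP n).1 _; rewrite ltr_pdivrMr// mulrC -ltr_pdivrMr//.
  apply: lt_le_trans (truncnS_gt _) _; by rewrite ler_nat ltnS.
have [|M [M0 MP]] := bF _ (compact_cvg_seq yp).
  move=> _ [->//|[n _ <-]]; apply: dO; apply: lt_le_trans (yP n).1 _.
  by rewrite ler_pdivrMr// ler_peMr ?(ltW d0)// ler1n.
(* At index trunc(M) + 1 > M the value of [f] exceeds the bound [M]. *)
have [_ [f Ff]] := yP (Num.truncn M).+1.
rewrite ltNge => /negP; apply.
have := MP (y (Num.truncn M).+1) f; rewrite rnormE lecR => Mf.
apply: le_trans (Mf _ Ff) _; first by right; exists (Num.truncn M).+1.
by rewrite ltW// truncnS_gt.
Qed.

(** The conclusion spells out a cluster point of the product topology: a basic neighbourhood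
    constrains finitely many coordinates [l], and [N] is the start of a tail. *)
Lemma pointwise_cluster_point (T : choiceType) (Omega : set T)
    (s : nat -> T -> R[i]) :
  (forall x, Omega x -> exists M : R, forall j, rnorm (s j x) <= M) ->
  exists c : T -> R[i], forall (N : nat) (l : seq T) (eps : R), 0 < eps ->
    exists2 m : nat, (N <= m)%N &
      forall x, x \in l -> Omega x -> rnorm (s m x - c x) < eps.
Proof.
move=> sb.
have /choice[B BP] : forall x, exists M : R,
    Omega x -> forall j, rnorm (s j x) <= M.
  move=> x; have [/sb[M MP]|nO] := pselect (Omega x); first by exists M.
  by exists 0.
(* Boundedness is known only on [Omega]; elsewhere the value 0 keeps the sequence in the product of
   discs, whose radii [Num.max 0 (B x)] are nonnegative. *)
pose s' j x := if x \in Omega then s j x else 0.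
have sE x j : Omega x -> s' j x = s j x by move=> Ox; rewrite /s' mem_set.
pose A (x : T) := [set z : R[i] | rnorm z <= Num.max 0 (B x)].
have cA := @tychonoff T (fun=> R[i]) A (fun x => @compact_disc R _).
have [|c [_ cc]] := cA (s' j @[j --> \oo]) _.
  exists 0%N => // j _ x; rewrite /A /=.
  have [Ox|nO] := pselect (Omega x); first by rewrite sE// le_max BP ?orbT.
  by rewrite /s' memNset// rnorm0 le_max lexx.
exists c => N l eps eps0.
pose U := [set h : T -> R[i] | forall x, x \in l -> rnorm (h x - c x) < eps].
have nU : nbhs c (U : set (prod_topology (fun _ : T => R[i]))).
  rewrite {}/U; elim: l => [|x l IH]; first by apply: filterE.
  have px : nbhs c [set h : prod_topology (fun _ : T => R[i]) |
      rnorm (h x - c x) < eps].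
    have nc : nbhs (c x) [set z : R[i] | rnorm (z - c x) < eps].
      by apply/nbhs_rnormP; exists eps.
    exact: (@proj_continuous T (fun=> R[i]) x c _ nc).
  apply: filterS (filterI px IH) => h [hx hl] z.
  by rewrite inE => /predU1P[->//|]; exact: hl.
have sN : (s' j @[j --> \oo]) (s' @` [set j | (N <= j)%N]).
  by exists N => // j Nj; exists j.
have [_ [[m Nm <-] mU]] := cc _ _ sN nU.
by exists m => // x /mU + Ox; rewrite sE.
Qed.

(** As [c] is known beforehand, no diagonal argument is required: index k is chosen to be good at d
    0, ..., d k simultaneously. *)
Lemma subsequence_near_cluster_point (T : choiceType) (Omega : set T)
    (s : nat -> T -> R[i]) (c : T -> R[i]) (d : nat -> T) :
  (forall (N : nat) (l : seq T) (eps : R), 0 < eps ->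
    exists2 m : nat, (N <= m)%N &
      forall x, x \in l -> Omega x -> rnorm (s m x - c x) < eps) ->
  exists2 phi : nat -> nat, {homo phi : m n / (m < n)%N} &
    forall k j, (j <= k)%N -> Omega (d j) ->
      rnorm (s (phi k) (d j) - c (d j)) < k.+1%:R^-1.
Proof.
move=> cs.
have /choice[h hP] : forall kN : nat * nat, exists m, (kN.2 <= m)%N /\
    forall j, (j <= kN.1)%N -> Omega (d j) ->
      rnorm (s m (d j) - c (d j)) < kN.1.+1%:R^-1.
  move=> [k N] /=.
  have [|m Nm mP] := cs N (map d (iota 0 k.+1)) k.+1%:R^-1.
    by rewrite invr_gt0.
  exists m; split => // j jk; apply: mP.
  by apply: map_f; rewrite mem_iota.
(* The second argument of [h] is a lower bound for the chosen index, so [phi] increases strictly. *)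
pose fix phi k := if k is k'.+1 then h (k, (phi k').+1) else h (0%N, 0%N).
exists phi; first by apply: homo_ltn ltn_trans _ => k; exact: (hP (_, _)).1.
by case=> [|k]; exact: (hP (_, _)).2.
Qed.

(** Indices outside the image of the injection receive arbitrary values, so [D] may be empty and [d]
    may leave it. *)
Lemma countable_enum (T : pointedType) (D : set T) : countable D ->
  exists d : nat -> T, forall x, D x -> exists n, d n = x.
Proof.
move=> /countable_injP[f fi].
have /choice[d dP] : forall n, exists x, (exists2 y, D y & f y = n) ->
    D x /\ f x = n.
  move=> n; have [[y Dy fy]|nD] := pselect (exists2 y, D y & f y = n).
    by exists y.
  by exists point => /nD.
exists d => x Dx; exists (f x); have [|Dd fd] := dP (f x); first by exists x.
by apply: fi; rewrite ?inE.
Qed.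

End Sequences.

(** * From equicontinuity to normal convergence *)

(** On a small ball around x, each point y is compared with one point z = d j of the dense set,
    where the subsequence converges to [c]. Compactness of K patches the balls together. *)
Lemma equicontinuous_normally_convergent (R : realType)
    (X : normedModType R[i]) (Omega : set X) (s : nat -> X -> R[i]) :
  separable X ->
  (forall x, Omega x -> exists M : R, forall j, rnorm (s j x) <= M) ->
  (forall (x : X) (eps : R), Omega x -> 0 < eps -> exists2 r : R, 0 < r &
    forall y, rnorm (y - x) < r ->
      Omega y /\ forall j, rnorm (s j y - s j x) <= eps) ->
  normally_convergent_subseq Omega s.
Proof.
move=> [D cD dD] sb sE.
have [d dP] := countable_enum cD.
have [c cP] := pointwise_cluster_point sb.
have [phi phi_incr phiP] := subsequence_near_cluster_point d cP.
exists phi; split => //; exists c => K cK KO.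
suff near_unif (eps : R) : 0 < eps -> \forall k \near \oo, K `<=`
    [set y | rnorm (s (phi k) y - c y) < eps].
  move=> P /uniform_nbhs[E []]; rewrite -entourage_ballE => -[e /= e0 eE] EP.
  have eR : (complex.Re e)%:C = e by rewrite RRe_real// gtr0_real.
  have e0' : 0 < complex.Re e by rewrite -ltcR eR.
  apply: filterS (near_unif _ e0') => k Kk; apply: EP => y /Kk /= ky.
  by apply: eE; rewrite /= -ball_normE /= rnormE rnorm_distC -eR ltcR.
move=> eps0; have e8 : 0 < eps / 8 by rewrite divr_gt0.
move: cK => /compact_near_coveringP cK.
apply: (cK _ _ (fun k y => rnorm (s (phi k) y - c y) < eps)) => x Kx.
have [r r0 rP] := sE x _ (KO x Kx) e8.
have [||z [zx /dP[j jz]]] := dD [set y | rnorm (y - x) < r].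
- by exists x; rewrite /= subrr rnorm0.
- rewrite openE => y /= yr; apply/nbhs_rnormP; exists (r - rnorm (y - x)).
    by rewrite subr_gt0.
  by move=> y' y'y; have := rnorm_distD y y' x; rewrite /=; lra.
exists ([set y | rnorm (y - x) < r],
  [set k | (j <= k)%N && (k.+1%:R^-1 < eps / 8)]) => /=.
  split; first by apply/nbhs_rnormP; exists r.
  (* Beyond [j] the bound [phiP] covers the point d j; beyond 8/eps it is less than eps/8. *)
  exists (maxn j (Num.truncn (8 / eps))) => // k /=; rewrite geq_max.
  move=> /andP[-> ke] /=; rewrite -[eps / 8]invf_div ltf_pV2 ?posrE ?divr_gt0//.
  by apply: lt_le_trans (truncnS_gt _) _; rewrite ler_nat ltnS.
move=> [y k] /= [yx /andP[jk ke]].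
have Oz : Omega z by have [] := rP z zx.
have Oy : Omega y by have [] := rP y yx.
have yz m : rnorm (s m y - s m z) <= eps / 4.
  have := (rP z zx).2 m; have := (rP y yx).2 m.
  have := rnorm_distD (s m x) (s m y) (s m z).
  by rewrite [rnorm (s m x - _)]rnorm_distC; lra.
(* The cluster property gives an index m, unrelated to [phi], at which the sequence is close to [c]
   at y and z at once, so [c] inherits the equicontinuity estimate. *)
have cyz : rnorm (c z - c y) < eps / 2.
  have [m _ mP] := cP 0%N [:: y; z] _ e8.
  have my : rnorm (s m y - c y) < eps / 8 by apply: mP; rewrite ?inE ?eqxx.
  have mz : rnorm (s m z - c z) < eps / 8.
    by apply: mP; rewrite ?inE ?eqxx ?orbT.
  have := yz m; have := rnorm_distD (s m z) (c z) (c y).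
  have := rnorm_distD (s m y) (s m z) (c y).
  rewrite [rnorm (c z - s _ _)]rnorm_distC [rnorm (s m z - s m y)]rnorm_distC.
  lra.
have ckz : rnorm (s (phi k) z - c z) < eps / 8.
  by apply: lt_trans ke; rewrite -jz; apply: phiP => //; rewrite jz.
have := yz (phi k); have := rnorm_distD (s (phi k) z) (s (phi k) y) (c y).
have := rnorm_distD (c z) (s (phi k) z) (c y).
lra.
Qed.

Theorem theorem1p8 (R : realType) (X : completeNormedModType R[i])
    (Omega : set X) (A : Type) (f : A -> X -> R[i]) :
  separable X ->
  is_domain Omega ->
  (forall alpha : A, holomorphic Omega (f alpha)) ->
  bounded_on_compacts Omega (range f) ->
  (forall s : nat -> X -> R[i], (forall j : nat, range f (s j)) ->
     normally_convergent_subseq Omega s) /\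
  normal_family Omega (range f).
Proof.
move=> sX [oO _] fhol fb.
have hol g : range f g -> holomorphic Omega g by move=> [a _ <-].
suff conv s : (forall j : nat, range f (s j)) ->
    normally_convergent_subseq Omega s.
  by split=> //; split=> // s /conv; left.
move=> sf; apply: equicontinuous_normally_convergent => // [x Ox|x eps Ox eps0].
  have [r [M [r0 _ rM]]] := locally_bounded oO fb Ox.
  by exists M => j; apply: rM => //; rewrite subrr rnorm0.
have [r [M [r0 rO rM]]] := locally_bounded oO fb Ox.
(* A bound on the ball of radius r yields a Lipschitz constant on the ball of half that radius, the
   same for all [s j]. *)
have r2 : 0 < r / 2 by rewrite divr_gt0.
have r2E : 2 * (r / 2) = r by field.
have M0 : 0 <= M.
  apply: le_trans (rnorm_ge0 (s 0%N x)) (rM _ _ _ (sf _)).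
  by rewrite subrr rnorm0.
pose L := M / (r / 2).
(* [L] vanishes when M = 0, so the radius below is obtained by dividing by [L + 1]. *)
have L1 : 0 < L + 1 by rewrite ltr_wpDl// divr_ge0// ltW.
exists (Num.min (r / 2) (eps / (L + 1))) => [|y].
  by rewrite lt_min r2 divr_gt0.
rewrite lt_min => /andP[yr ye]; split; first by apply: rO; lra.
move=> j; have [sC1 sDbar] := hol _ (sf j).
have := @bounded_lipschitz _ _ _ _ oO sC1 sDbar x (r / 2) M r2.
rewrite r2E => /(_ rO (fun y yr => rM y _ yr (sf j)) x y).
rewrite subrr rnorm0 => /(_ r2 yr) /le_trans; apply.
move: ye; rewrite ltr_pdivlMr// => ye; apply: le_trans (ltW ye).
by rewrite mulrC ler_wpM2l ?rnorm_ge0// lerDl.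
Qed.
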